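(* For any $u\in C_c(\mathbb{N})$ with $u_0=u_1=0$, there holds $$\sum_{n=2}^\infty n |\nabla u_n|^2 \geq \frac{1}{4}\sum_{n=2}^\infty \frac{|u_n|^2}{n(\ln n)^2}.$$
   Context: $\mathbb{N}=\{0,1,2,\dots\}$, $C_c(\mathbb{N})$ is the space of finitely supported real sequences $u=(u_n)_{n\in\mathbb{N}}$, and $\nabla u_n = u_n-u_{n-1}$ for $n\geq 1$. *)

(* Defs.v *)
From mathcomp Require Import all_boot all_order all_algebra.
From mathcomp Require Import all_classical all_reals all_analysis.

Set Implicit Arguments.
Unset Strict Implicit.
Unset Printing Implicit Defensive.

Import Order.TTheory GRing.Theory Num.Theory.
Local Open Scope classical_set_scope.
Local Open Scope ring_scope.

Definition finitely_supported (R : realType) (u : nat -> R) : Prop :=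
  finite_set [set n | u n != 0].

(* Meaningful only for n >= 1; since 0.-1 = 0, the value at n = 0 is 0. *)
Definition nabla (R : realType) (u : nat -> R) (n : nat) : R :=
  u n - u n.-1.

(* Main.v *)
(** The sequence phi_n = sqrt (ln n) is a positive supersolution of the weighted
    discrete Laplacian: n (1 - phi_(n-1) / phi_n) - (n+1) (phi_(n+1) / phi_n - 1)
    is at least 1 / (4 n (ln n)^2) for n >= 2. Multiplying this by (u_n)^2 and
    applying the Picone inequality to each edge (n-1, n) bounds every partial
    sum. With a = ln (n / (n-1)) and b = ln ((n+1) / n), a third-order Taylor
    bound on the square roots reduces the supersolution inequality to
    (n+1) b <= n a (which controls the terms of first and third order) and
    b >= 2 / (2n+1) (which yields the main term, of second order). *)

Require Import Defs.
From mathcomp Require Import all_boot all_order all_algebra.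
From mathcomp Require Import all_classical all_reals all_analysis.
From mathcomp Require Import ring lra.

Import Order.TTheory GRing.Theory Num.Theory.
Import numFieldNormedType.Exports.
Local Open Scope classical_set_scope.
Local Open Scope ring_scope.

(** The cubic [p] is nonnegative on [[-1, +oo)], and [p ^+ 2] exceeds [1 + x] by [x ^+ 4] times a
    positive quadratic. *)
Lemma sqrt1D_le_taylor3 (R : rcfType) (x : R) : -1 <= x ->
  Num.sqrt (1 + x) <= 1 + x / 2 - x ^+ 2 / 8 + x ^+ 3 / 16.
Proof.
move=> x_ge; set p := (X in _ <= X).
have p_ge0 : 0 <= p.
  (* Euclidean division of [16 p] by [1 + x], with the square completed in the quotient. *)
  have -> : p = ((1 + x) * ((x - 3 / 2) ^+ 2 + 35 / 4) + 5) / 16.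
    by rewrite /p; field.
  have sq_ge0 := sqr_ge0 (x - 3 / 2).
  by rewrite divr_ge0// addr_ge0// mulr_ge0//; lra.
rewrite -(ger0_norm p_ge0) -sqrtr_sqr ler_wsqrtr//.
have -> : p ^+ 2 = 1 + x + x ^+ 4 * (((x - 2) ^+ 2 + 16) / 256).
  by rewrite /p; field.
by rewrite lerDl mulr_ge0 ?exprn_even_ge0// divr_ge0// addr_ge0 ?sqr_ge0.
Qed.

Lemma ge0_of_derive_ge0 (R : realType) (f df : R -> R) :
  (forall x : R, 1 <= x -> is_derive x 1 f (df x)) ->
  (forall x : R, 1 <= x -> 0 <= df x) -> 0 <= f 1 ->
  forall x : R, 1 <= x -> 0 <= f x.
Proof.
move=> fdf df_ge0 f1 x x_ge1.
have [y||c] := @MVT_segment R f df 1 x x_ge1.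
- by rewrite in_itv/= => /andP[y_gt1 _]; apply: fdf; exact: ltW.
- apply: derivable_within_continuous => y; rewrite in_itv/= => /andP[y_ge1 _].
  by have [] := fdf y y_ge1.
- rewrite in_itv/= => /andP[c_ge1 _] /eqP; rewrite subr_eq => /eqP ->.
  by rewrite addr_ge0// mulr_ge0 ?df_ge0// subr_ge0.
Qed.

(** The left side is the [1/1] Padé approximant of [ln] at 1; the difference vanishes at 1 and has a
    nonnegative derivative. *)
Lemma ln_ge_pade (R : realType) (x : R) :
  1 <= x -> 2 * (x - 1) / (x + 1) <= ln x.
Proof.
move=> x_ge1; rewrite -subr_ge0; move: x x_ge1.
apply: (@ge0_of_derive_ge0 R _
  (fun x => (x - 1) ^+ 2 / (x * (x + 1) ^+ 2))) => [x x_ge1|x x_ge1|].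
- have x_gt0 : 0 < x by lra.
  have x1_neq0 : x + 1 != 0 by lra.
  have x_neq0 : x != 0 by lra.
  have dln := is_derive1_ln x_gt0.
  have dV := @is_deriveV _ (fun y : R => y + 1) x _ 1 x1_neq0 _.
  apply: is_derive_eq.
  by rewrite /GRing.scale/=; field; rewrite x_neq0 x1_neq0.
- by rewrite divr_ge0 ?sqr_ge0// mulr_ge0 ?sqr_ge0//; lra.
- by rewrite ln1; lra.
Qed.

Lemma ln_le_half_subV (R : realType) (x : R) :
  1 <= x -> ln x <= (x - x^-1) / 2.
Proof.
move=> x_ge1; rewrite -subr_ge0; move: x x_ge1.
apply: (@ge0_of_derive_ge0 R _
  (fun x => (x - 1) ^+ 2 / (2 * x ^+ 2))) => [x x_ge1|x x_ge1|].
- have x_gt0 : 0 < x by lra.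
  have x_neq0 : x != 0 by lra.
  have dln := is_derive1_ln x_gt0.
  have dV := @is_deriveV _ (fun y : R => y) x _ 1 x_neq0 _.
  apply: is_derive_eq.
  by rewrite /GRing.scale/=; field; rewrite x_neq0.
- by rewrite divr_ge0 ?sqr_ge0// mulr_ge0 ?sqr_ge0//; lra.
- by rewrite ln1 invr1; lra.
Qed.

Lemma sqrt_ratio_coef_ge (R : rcfType) (m L a b : R) :
  1 <= m -> 0 < L -> a <= L -> 2 / (2 * m + 1) <= b -> (m + 1) * b <= m * a ->
  1 / 4 / (m * L ^+ 2) <=
  m * (1 - Num.sqrt (1 - a / L)) - (m + 1) * (Num.sqrt (1 + b / L) - 1).
Proof.
move=> m_ge1 L_gt0 aL b_ge ba.
have b_gt0 : 0 < b by apply: lt_le_trans b_ge; rewrite divr_gt0//; lra.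
pose x := a / L; pose y := b / L.
have y_gt0 : 0 < y by exact: divr_gt0.
have x_le1 : x <= 1 by rewrite ler_pdivrMr// mul1r.
have yx : (m + 1) * y <= m * x.
  by rewrite !mulrA ler_pM2r// invr_gt0.
have y_lex : y <= x by nra.
have sx := @sqrt1D_le_taylor3 R (- x) ltac:(lra).
have sy := @sqrt1D_le_taylor3 R y ltac:(lra).
rewrite -/x -/y.
(* Since [m a >= (m + 1) b], the numerator is at least [(m + 1) (2 m + 1) b^2], hence at least
   [((2 m + 1) b)^2 / 2 >= 2]. *)
have sq : 2 / (m * L ^+ 2) <= m * x ^+ 2 + (m + 1) * y ^+ 2.
  have h1 : 2 <= (2 * m + 1) * b.
    by move: b_ge; rewrite ler_pdivrMr 1?mulrC//; lra.
  have -> : m * x ^+ 2 + (m + 1) * y ^+ 2 =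
     ((m * a) ^+ 2 + m * (m + 1) * b ^+ 2) / (m * L ^+ 2).
    by rewrite /x /y; field; apply/andP; split; lra.
  rewrite ler_pM2r ?invr_gt0 ?mulr_gt0 ?exprn_gt0//; last by lra.
  have h2 : ((m + 1) * b) ^+ 2 <= (m * a) ^+ 2.
    by rewrite ler_pXn2r// nnegrE; nra.
  have h3 : 2 ^+ 2 <= ((2 * m + 1) * b) ^+ 2.
    by rewrite ler_pXn2r// nnegrE; nra.
  have h4 : 0 <= m * b ^+ 2 by rewrite mulr_ge0 ?sqr_ge0//; lra.
  have h5 : 0 <= b ^+ 2 by rewrite sqr_ge0.
  nra.
(* Product of [yx] with [y ^+ 2 <= x ^+ 2]. *)
have cb : (m + 1) * y ^+ 3 <= m * x ^+ 3.
  rewrite ![_ ^+ 3]exprS (mulrA _ y) (mulrA _ x) ler_pM//.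
  - by apply: mulr_ge0; lra.
  - exact: sqr_ge0.
  - by rewrite ler_pXn2r// nnegrE; lra.
have -> : 1 / 4 / (m * L ^+ 2) = 2 / (m * L ^+ 2) / 8.
  by field; apply/andP; split; lra.
have mx : m * Num.sqrt (1 - x) <=
    m * (1 + (- x) / 2 - (- x) ^+ 2 / 8 + (- x) ^+ 3 / 16).
  by rewrite ler_pM2l//; lra.
have my : (m + 1) * Num.sqrt (1 + y) <=
    (m + 1) * (1 + y / 2 - y ^+ 2 / 8 + y ^+ 3 / 16).
  by rewrite ler_pM2l//; lra.
rewrite sqrrN in mx.
have e3 : (- x) ^+ 3 = - x ^+ 3 by ring.
rewrite e3 in mx.
lra.
Qed.

Lemma sqrt_ln_supersolution (R : realType) (m : R) : 2 <= m ->
  1 / 4 / (m * ln m ^+ 2) <=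
  m * (1 - Num.sqrt (ln (m - 1)) / Num.sqrt (ln m)) -
  (m + 1) * (Num.sqrt (ln (m + 1)) / Num.sqrt (ln m) - 1).
Proof.
move=> m_ge2.
have L_gt0 : 0 < ln m by rewrite ln_gt0//; lra.
have Lp : 0 <= ln (m - 1) by rewrite ln_ge0//; lra.
have Ls : 0 <= ln (m + 1) by rewrite ln_ge0//; lra.
rewrite -!sqrtrV ?(ltW L_gt0)// -!sqrtrM//.
have Ea : ln (m / (m - 1)) = ln m - ln (m - 1).
  by rewrite ln_div// posrE; lra.
have Eb : ln ((m + 1) / m) = ln (m + 1) - ln m.
  by rewrite ln_div// posrE; lra.
have -> : ln (m - 1) / ln m = 1 - ln (m / (m - 1)) / ln m.
  by rewrite Ea; field; lra.
have -> : ln (m + 1) / ln m = 1 + ln ((m + 1) / m) / ln m.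
  by rewrite Eb; field; lra.
have ma_ge1 : 1 <= m / (m - 1) by rewrite ler_pdivlMr; lra.
have mb_ge1 : 1 <= (m + 1) / m by rewrite ler_pdivlMr; lra.
have a_ge := @ln_ge_pade R _ ma_ge1.
have b_ge := @ln_ge_pade R _ mb_ge1.
have b_le := @ln_le_half_subV R _ mb_ge1.
apply: sqrt_ratio_coef_ge => //; first by lra.
(* Equality holds at [m = 2], where [ln (m - 1) = 0]: the Taylor bound is then used at its endpoint
   -1. *)
- by rewrite Ea; lra.
- apply: le_trans b_ge; rewrite le_eqVlt; apply/orP; left; apply/eqP; field.
  by do ?[apply/andP; split]; lra.
(* The rational bounds on the logarithms separate the two sides: [(m + 1) b <= 1 + 1 / (2 m)] and
   [m a >= 1 + 1 / (2 m - 1)]. *)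
- apply: (@le_trans _ _ ((m + 1) * (((m + 1) / m - ((m + 1) / m)^-1) / 2))).
    by rewrite ler_pM2l//; lra.
  apply: (@le_trans _ _ (m * (2 * (m / (m - 1) - 1) / (m / (m - 1) + 1)))).
    rewrite -subr_ge0.
    have -> : m * (2 * (m / (m - 1) - 1) / (m / (m - 1) + 1)) -
      (m + 1) * (((m + 1) / m - ((m + 1) / m)^-1) / 2) =
      (2 * m * (2 * m - 1))^-1.
      by field; do ?[apply/andP; split]; lra.
    by rewrite invr_ge0 !mulr_ge0//; lra.
  by rewrite ler_pM2l//; lra.
Qed.

(** The gap between the two sides is the square [(p a - q b)^2 / (p q)]. *)
Lemma picone_edge (R : realFieldType) (p q a b : R) :
  0 < p -> 0 < q ->
  (1 - p / q) * a ^+ 2 <= (a - b) ^+ 2 + (q / p - 1) * b ^+ 2.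
Proof.
move=> p_gt0 q_gt0; rewrite -subr_ge0.
have -> : (a - b) ^+ 2 + (q / p - 1) * b ^+ 2 - (1 - p / q) * a ^+ 2 =
  (p * a - q * b) ^+ 2 / (p * q).
  by field; apply/andP; split; lra.
by rewrite divr_ge0 ?sqr_ge0// mulr_ge0// ltW.
Qed.

(* The extra term on the left is what the Picone inequality on the next edge
   (N, N+1) consumes. At N = 1 it is a division by zero, killed by [u 1 = 0]. *)
Lemma hardy_partial_sum (R : realType) (u : nat -> R) (N : nat) :
  u 1 = 0 -> (1 <= N)%N ->
  \sum_(2 <= n < N.+1) 1 / 4 * (`|u n| ^+ 2 / (n%:R * ln n%:R ^+ 2)) +
  N.+1%:R * (Num.sqrt (ln N.+1%:R) / Num.sqrt (ln N%:R) - 1) * u N ^+ 2 <=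
  \sum_(2 <= n < N.+1) n%:R * `|nabla u n| ^+ 2.
Proof.
move=> u1; elim: N => // -[_ _|N /(_ isT) IH _].
  by rewrite !big_geq// u1 expr0n/= mulr0 addr0.
rewrite !(big_nat_recr N.+2)//=.
set S := \sum_(_ <= _ < _) _ in IH *.
set T := \sum_(_ <= _ < _) _ in IH *.
rewrite /nabla/= !real_normK ?num_real//.
set n := N.+2%:R in IH *.
have n_ge2 : 2 <= n :> R by rewrite ler_nat.
have En : N.+1%:R = n - 1 :> R by rewrite /n -[in RHS]natr1 addrK.
have En1 : N.+3%:R = n + 1 :> R by rewrite /n natr1.
have := @sqrt_ln_supersolution R _ n_ge2.
rewrite -En -En1.
set p := Num.sqrt (ln N.+1%:R) in IH *; set q := Num.sqrt (ln n) in IH *.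
set r := Num.sqrt (ln _).
move=> super.
have q_gt0 : 0 < q by rewrite sqrtr_gt0 ln_gt0//; lra.
have edge : (1 - p / q) * u N.+2 ^+ 2 <=
    (u N.+2 - u N.+1) ^+ 2 + (q / p - 1) * u N.+1 ^+ 2.
  (* On the edge (1, 2), [p = 0] and [picone_edge] does not apply; as [u 1 = 0], both sides equal
     [u 2 ^+ 2]. *)
  have [N0|N_gt0] := posnP N.
    by rewrite /p N0 ln1 sqrtr0 u1 mul0r expr0n/= mulr0 !subr0 mul1r addr0.
  by apply: picone_edge => //; rewrite sqrtr_gt0 ln_gt0// ltr1n.
(* Once the edge inequality is multiplied by [n], its last term is the extra term of [IH], and its
   left side is the first term of [super] times [u N.+2 ^+ 2]. *)
have := ler_wpM2l (sqr_ge0 (u N.+2)) super.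
have := ler_wpM2l (_ : 0 <= n) edge.
move=> /(_ ltac:(lra)).
have -> : 1 / 4 * (u N.+2 ^+ 2 / (n * ln n ^+ 2)) =
  u N.+2 ^+ 2 * (1 / 4 / (n * ln n ^+ 2)) by ring.
move: IH; move: (q / p - 1) (1 - p / q) (N.+3%:R * (r / q - 1)) (1 / 4 / _).
by clearbody S T n => c d e w; lra.
Qed.

Theorem theorem1p4 (R : realType) (u : nat -> R)
    (hu : finitely_supported u) (hu0 : u 0%N = 0) (hu1 : u 1%N = 0) :
  (\sum_(2 <= n <oo) (n%:R * `|nabla u n| ^+ 2)%:E >=
   (1 / 4)%:E * \sum_(2 <= n <oo) (`|u n| ^+ 2 / (n%:R * ln (n%:R) ^+ 2))%:E)%E.
Proof.
have w_ge0 n : 0 <= `|u n| ^+ 2 / (n%:R * ln (n%:R) ^+ 2).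
  by rewrite divr_ge0 ?sqr_ge0// mulr_ge0 ?sqr_ge0.
rewrite -nneseriesZl; last by move=> n _; rewrite lee_fin.
apply: lee_lim.
- by apply: is_cvg_nneseries => n _ _; rewrite -EFinM lee_fin mulr_ge0.
- by apply: is_cvg_nneseries => n _ _; rewrite lee_fin mulr_ge0 ?sqr_ge0.
exists 3%N => // -[|[|[|M _]]]//=.
under eq_bigr do rewrite -EFinM.
rewrite !sumEFin lee_fin.
apply: le_trans (@hardy_partial_sum R u _ hu1 (ltn0Sn M.+1)).
rewrite lerDl mulr_ge0 ?sqr_ge0// mulr_ge0// subr_ge0 ler_pdivlMr ?mul1r.
  by rewrite ler_wsqrtr// ler_ln ?posrE// ler_nat.
by rewrite sqrtr_gt0 ln_gt0// ltr1n.
Qed.
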